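(* Let $C$ be a full-dimensional, bounded, convex subset of $\mathbb{R}^d$, let $\mathcal{H}$ be a hyperplane arrangement in $\mathbb{R}^d$ not containing the degenerate hyperplane, and let $D$ be a discrete set in $\mathbb{R}^d$. Then $$E^\circ_{C,\mathcal{H}}(D) = \sum_{u\in \mathcal{L}(\mathcal{H})}\mu(\hat 0,u)\, \#(D\cap C\cap u),$$ and if $\mathcal{H}$ is transverse to $C$, then $$E_{C,\mathcal{H}}(D) = \sum_{u\in \mathcal{L}(\mathcal{H})} |\mu(\hat 0,u)|\, \#(D\cap C\cap u),$$ where $\mu$ is the Möbius function of $\mathcal{L}(\mathcal{H})$.
   Context: A hyperplane arrangement $\mathcal{H}$ in $\mathbb{R}^d$ is a finite set of affine hyperplanes; the whole space $\mathbb{R}^d$ is also allowed as a member and is then called the degenerate hyperplane. The intersection semilattice is $\mathcal{L}(\mathcal{H}) = \{\bigcap\mathcal{S} : \mathcal{S}\subseteq\mathcal{H},\ \bigcap\mathcal{S}\neq\varnothing\}$, ordered by reverse inclusion, with minimum $\hat 0=\bigcap\varnothing=\mathbb{R}^d$; its elements are called flats. The Möbius function of a finite poset is defined by $\mu(r,s)=0$ if $r\not\le s$, $\mu(r,r)=1$, and $\mu(r,s)=-\sum_{r\le u<s}\mu(r,u)$ if $r<s$. For a convex set $C$, $\bar C$ is its topological closure and $C^\circ$ its relative interior. $\mathcal{H}$ is transverse to $C$ if every flat $u\in\mathcal{L}(\mathcal{H})$ that intersects $\bar C$ also intersects $C^\circ$, and $C$ does not lie in any of the hyperplanes of $\mathcal{H}$.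 A closed region of $(C,\mathcal{H})$ is the closure of a connected component of $C\setminus\bigcup\mathcal{H}$. The multiplicity $m_{C,\mathcal{H}}(x)$ of $x\in\mathbb{R}^d$ is the number of closed regions of $(C,\mathcal{H})$ that contain $x$ if $x\in C$, and is $0$ if $x\notin C$. The closed and open $D$-enumerators are $$E_{C,\mathcal{H}}(D)=\sum_{x\in D}m_{C,\mathcal{H}}(x),\qquad E^\circ_{C,\mathcal{H}}(D)=\#\bigl(D\cap C\setminus\textstyle\bigcup\mathcal{H}\bigr).$$ ''Discrete set'' means locally finite: every bounded subset of $\mathbb{R}^d$ contains only finitely many points of $D$. *)

(* Defs.v *)
From HB Require Import structures.
From mathcomp Require Import all_boot all_order all_algebra finmap.
From mathcomp Require Import all_classical all_reals all_analysis.

Set Implicit Arguments.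
Unset Strict Implicit.
Unset Printing Implicit Defensive.

Import Order.TTheory GRing.Theory Num.Theory.
Import numFieldNormedType.Exports.

Local Open Scope classical_set_scope.
Local Open Scope ring_scope.

(* Only used on finite sets: [fset_set] sends an infinite set to [fset0]. *)
Definition count_set (T : choiceType) (A : set T) : nat := #|` fset_set A|%fset.

(* The recursion of the Möbius function, cut off after [n] unfoldings.  For a
   finite [P], #|P| unfoldings are enough; lemmas [mobius_nle], [mobiusxx] and
   [mobius_lt] are the usual defining equations. *)
Fixpoint mobius_rec (disp : Order.disp_t) (T : porderType disp) (P : set T)
    (n : nat) (r s : T) : int :=
  if n is n'.+1 then
    if r == s then 1
    else if (r < s)%O then
      - \sum_(u \in P `&` [set u | (r <= u < s)%O]) mobius_rec P n' r u
    else 0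
  else 0.

Definition mobius (disp : Order.disp_t) (T : porderType disp) (P : set T)
    (r s : T) : int := mobius_rec P (count_set P) r s.

Lemma count_set_gt0 (T : choiceType) (A : set T) (x : T) :
  finite_set A -> A x -> (0 < count_set A)%N.
Proof.
move=> finA Ax; rewrite cardfs_gt0; apply/fset0Pn; exists x.
by rewrite in_fset_set// mem_set.
Qed.

Lemma count_set_lt (T : choiceType) (A B : set T) (x : T) :
  finite_set B -> A `<=` B -> B x -> ~ A x -> (count_set A < count_set B)%N.
Proof.
move=> finB AB Bx Ax; have finA := sub_finite_set AB finB.
apply: fproper_ltn_card; rewrite fproperE; apply/andP; split.
  by apply/fsubsetP => y; rewrite !in_fset_set// !inE => /AB.
by apply/negP => /fsubsetP/(_ x); rewrite !in_fset_set// !inE => /(_ Bx).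
Qed.

Lemma mobius_rec_nle (disp : Order.disp_t) (T : porderType disp) (P : set T)
  (n : nat) (r s : T) : ~~ (r <= s)%O -> mobius_rec P n r s = 0.
Proof.
move=> nrs; case: n => //= n.
case: eqVneq nrs => [->|_ nrs]; first by rewrite lexx.
by case: ifP => // /ltW rs; rewrite rs in nrs.
Qed.

Lemma mobius_rec_fuel (disp : Order.disp_t) (T : porderType disp) (P : set T)
    (n m : nat) (r s : T) : finite_set P -> P r -> P s ->
  (count_set (P `&` [set u | (r <= u <= s)%O]) <= n)%N ->
  (count_set (P `&` [set u | (r <= u <= s)%O]) <= m)%N ->
  mobius_rec P n r s = mobius_rec P m r s.
Proof.
move=> finP Pr; have finI (A : set T) : finite_set (P `&` A) by exact: finite_setIl.
elim: n m s => [|n IHn] m s Ps len lem.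
all: have [rs|nrs] := boolP (r <= s)%O; last by rewrite !mobius_rec_nle.
all: have c0 : (0 < count_set (P `&` [set u | (r <= u <= s)%O]))%N
  by apply: (@count_set_gt0 _ _ r) => //; split => //=; rewrite lexx.
  by have := leq_trans c0 len.
case: m lem => [|m] lem; first by have := leq_trans c0 lem.
rewrite /=; case: eqVneq => // _; case: ifP => // {}rs.
congr (- _); apply: eq_fsbigr => u; rewrite inE => -[Pu /andP[ru us]].
have lt_us : (count_set (P `&` [set v | (r <= v <= u)%O]) <
              count_set (P `&` [set v | (r <= v <= s)%O]))%N.
  apply: (@count_set_lt _ _ _ s) => //.
  - by move=> v [Pv /andP[rv vu]]; split => //=; rewrite rv (le_trans vu (ltW us)).
  - by split => //=; rewrite lexx ltW.
  - by move=> [_ /andP[_ /le_lt_trans/(_ us)]]; rewrite ltxx.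
by apply: IHn => //; rewrite -ltnS; apply: leq_trans lt_us _.
Qed.

Lemma mobius_nle (disp : Order.disp_t) (T : porderType disp) (P : set T)
  (r s : T) : ~~ (r <= s)%O -> mobius P r s = 0.
Proof. exact: mobius_rec_nle. Qed.

Lemma mobiusxx (disp : Order.disp_t) (T : porderType disp) (P : set T) (r : T) :
  finite_set P -> P r -> mobius P r r = 1.
Proof.
move=> finP /(count_set_gt0 finP); rewrite /mobius.
by case: count_set => //= n _; rewrite eqxx.
Qed.

Lemma mobius_lt (disp : Order.disp_t) (T : porderType disp) (P : set T)
    (r s : T) : finite_set P -> P r -> P s -> (r < s)%O ->
  mobius P r s = - \sum_(u \in P `&` [set u | (r <= u < s)%O]) mobius P r u.
Proof.
move=> finP Pr Ps rs; have := count_set_gt0 finP Pr.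
case E : (count_set P) => [//|n] _.
have -> : mobius P r s = mobius_rec P n.+1 r s by rewrite /mobius E.
rewrite /= (lt_eqF rs) rs; congr (- _).
apply: eq_fsbigr => u; rewrite inE => -[Pu /andP[ru us]].
have lt_us : (count_set (P `&` [set v | (r <= v <= u)%O]) < count_set P)%N.
  apply: (@count_set_lt _ _ _ s) => //.
  by move=> [_ /andP[_ /le_lt_trans/(_ us)]]; rewrite ltxx.
apply: mobius_rec_fuel => //; first by rewrite -ltnS -E.
exact: ltnW.
Qed.

Definition is_hyperplane (R : realType) (d : nat) (A : set 'rV[R]_d) : Prop :=
  exists (a : 'rV[R]_d) (b : R),
    a != 0 /\ A = [set x | \sum_(i < d) a ord0 i * x ord0 i = b].

(* [setT] is the degenerate hyperplane. *)
Definition is_arrangement (R : realType) (d : nat) (H : set (set 'rV[R]_d)) :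
    Prop :=
  finite_set H /\ forall A, H A -> is_hyperplane A \/ A = setT.

Definition flats (R : realType) (d : nat) (H : set (set 'rV[R]_d)) :
    set (set 'rV[R]_d) :=
  [set u | u !=set0 /\
     exists S : set (set 'rV[R]_d), S `<=` H /\ u = \bigcap_(A in S) A].

(* [set _] is ordered by inclusion in the library, so its dual order is the
   reverse inclusion of the intersection semilattice. *)
Definition mobius_flats (R : realType) (d : nat) (H : set (set 'rV[R]_d))
    (u v : set 'rV[R]_d) : int :=
  @mobius _ ((set 'rV[R]_d)^d)%type (flats H) u v.

Definition affine_set (R : realType) (d : nat) (A : set 'rV[R]_d) : Prop :=
  forall (x y : 'rV[R]_d) (t : R), A x -> A y -> A (x + t *: (y - x)).

Definition affine_hull (R : realType) (d : nat) (C : set 'rV[R]_d) :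
    set 'rV[R]_d := smallest (@affine_set R d) C.

Definition full_dimensional (R : realType) (d : nat) (C : set 'rV[R]_d) : Prop :=
  affine_hull C = setT.

Definition relative_interior (R : realType) (d : nat) (C : set 'rV[R]_d) :
    set 'rV[R]_d :=
  [set x | C x /\ \forall y \near x, affine_hull C y -> C y].

Definition locally_finite_set (R : realType) (d : nat) (D : set 'rV[R]_d) :
    Prop :=
  forall B : set 'rV[R]_d, bounded_set B -> finite_set (D `&` B).

Definition transverse (R : realType) (d : nat) (H : set (set 'rV[R]_d))
    (C : set 'rV[R]_d) : Prop :=
  (forall u, flats H u ->
     u `&` closure C !=set0 -> u `&` relative_interior C !=set0) /\
  (forall A, H A -> ~ C `<=` A).

Definition arrangement_compl (R : realType) (d : nat) (C : set 'rV[R]_d)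
    (H : set (set 'rV[R]_d)) : set 'rV[R]_d := C `\` \bigcup_(A in H) A.

Definition closed_regions (R : realType) (d : nat) (C : set 'rV[R]_d)
    (H : set (set 'rV[R]_d)) : set (set 'rV[R]_d) :=
  [set closure (connected_component (arrangement_compl C H) x)
     | x in arrangement_compl C H].

Definition multiplicity (R : realType) (d : nat) (C : set 'rV[R]_d)
    (H : set (set 'rV[R]_d)) (x : 'rV[R]_d) : nat :=
  if x \in C then count_set (closed_regions C H `&` [set K | K x]) else 0%N.

(* [\sum_(x \in D)] is 0 when infinitely many terms are nonzero, which cannot
   happen for [C] bounded and [D] locally finite. *)
Definition closed_enumerator (R : realType) (d : nat) (C : set 'rV[R]_d)
    (H : set (set 'rV[R]_d)) (D : set 'rV[R]_d) : nat :=
  \sum_(x \in D) multiplicity C H x.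

Definition open_enumerator (R : realType) (d : nat) (C : set 'rV[R]_d)
    (H : set (set 'rV[R]_d)) (D : set 'rV[R]_d) : nat :=
  count_set (D `&` arrangement_compl C H).

(* Main.v *)
Require Import Defs.
From HB Require Import structures.
From mathcomp Require Import all_boot all_order all_algebra finmap.
From mathcomp Require Import all_classical all_reals all_analysis.
From mathcomp Require Import ring.

Set Implicit Arguments.
Unset Strict Implicit.
Unset Printing Implicit Defensive.

Import Order.TTheory GRing.Theory Num.Theory.
Import numFieldNormedType.Exports.

Local Open Scope classical_set_scope.
Local Open Scope ring_scope.

(** Both identities hold point by point: a point [z] of [D `&` C] contributes
    to the right-hand sides the sum of [mu(0,u)], respectively [|mu(0,u)|], over
    the flats [u] through [z].  After exchanging the order of summation
    ([sum_mul_count_set]) each formula becomes a statement about one point.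

    The flats through [z] are those between the bottom [setT] and the smallest
    flat through [z], so the defining recursion of the Möbius function makes the
    first sum 1 if no hyperplane passes through [z] and 0 otherwise
    ([sum_mobius_through]).

    At a point [x] of [C] the second identity combines Zaslavsky's theorem for
    the hyperplanes through [x] with a local-to-global argument.  The
    hyperplanes through [x] are replaced by the list [s] of their normals, and
    flats through [x] by row spaces [F].  Deletion-restriction removes the first
    normal [a] of [s] and compares [F] with [slice F a], the part of [F]
    orthogonal to [a].  The quantities below obey the same recursion, up to
    signs.
    - [mobius_wt s F u] satisfies [w (a :: s) F = w s F - w s (slice F a)].  Its
      sums over the flats containing [v] are those that characterise the Möbius
      function, so for the whole space it is [mu(0,u)] ([sum_mobius_wt_above],
      [mobius_flats_unique]).
    - [mobius_abs] has the same recursion with a plus sign.  Passing from [F] to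
      [slice F a] lowers the dimension by one, hence the sign of [mobius_wt] is
      the parity of a codimension and [mobius_abs] is its absolute value
      ([normr_mobius_wt]).
    - The sum of [mobius_abs] over all flats and the number of sign patterns of
      [s] realised on [F] agree: cutting [F] by [a] duplicates the patterns that
      also occur on [slice F a] ([nregions_cons], [sum_mobius_abs]).

    It remains to see that the closed regions at [x] correspond to the sign
    patterns realised by the hyperplanes through [x]
    ([closed_regions_at]).  A connected component of the complement in the
    convex set [C] is a set of points with prescribed signs ([componentE]).
    At the hyperplanes that miss [x] the signs are forced by [x]; at those
    through [x] every realisable pattern occurs: transversality gives a point
    [y0] of the interior of [C] on all the hyperplanes through [x], so that a
    small displacement of [y0] realises the pattern inside [C], and by convexity
    the segment from [x] to the displaced point enters the region from [x]
    ([closure_cone_self]). *)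

(** * Sums over finite sets *)

Lemma count_set_seq (T : choiceType) (r : seq T) : uniq r ->
  count_set [set` r] = size r.
Proof.
move=> ur; apply: perm_size; apply: uniq_perm => // z.
by rewrite in_fset_set ?finite_seq //; apply/idP/idP => [/set_mem|zr] //; exact/mem_set.
Qed.

Lemma Posz_fsum (T : choiceType) (E : set T) (f : T -> nat) : finite_set E ->
  (\sum_(z \in E) f z)%:Z = \sum_(z \in E) (f z)%:Z.
Proof. by move=> finE; rewrite !fsbig_finite // (big_morph Posz PoszD erefl). Qed.

Lemma count_setIE (T : choiceType) (E u : set T) : finite_set E ->
  (count_set (E `&` u))%:Z = \sum_(z \in E) ((`[< u z >])%:R : int).
Proof.
move=> finE; have -> : E `&` u = [set` [seq z <- fset_set E | `[< u z >]]].
  apply/seteqP; split=> z /=; rewrite mem_filter in_fset_set //.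
    by move=> [Ez uz]; rewrite mem_set // andbT; apply/asboolP.
  by move=> /andP[/asboolP uz /set_mem].
rewrite count_set_seq ?filter_uniq ?fset_uniq // size_filter -sum1_count.
rewrite fsbig_finite // big_mkcond (big_morph Posz PoszD erefl).
by apply: eq_bigr => z _; case: `[< u z >].
Qed.

(** Double counting of the pairs of a set [u] and a point [z] of [E] in [u]. *)
Lemma sum_mul_count_set (T : choiceType) (E : set T) (L : set (set T))
    (f : set T -> int) : finite_set E -> finite_set L ->
  \sum_(u \in L) f u * (count_set (E `&` u))%:Z =
  \sum_(z \in E) \sum_(u \in L `&` [set u | u z]) f u.
Proof.
move=> finE finL; transitivity
    (\sum_(u \in L) \sum_(z \in E) f u * ((`[< u z >])%:R : int)).
  by apply: eq_fsbigr => u _; rewrite count_setIE // mulr_fsumr.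
rewrite exchange_fsbig //; apply: eq_fsbigr => z _.
rewrite fsbig_mkcondr; apply: eq_fsbigr => u _.
case: asboolP => uz.
  by rewrite mulr1 mem_set.
by rewrite mulr0 memNset.
Qed.

(** * Möbius functions of finite posets and of the lattice of flats *)

Section Mobius.
Context (disp : Order.disp_t) (T : porderType disp) (P : set T).
Context (finP : finite_set P).

Lemma sum_interval_last (f : T -> int) (r s : T) : P s -> (r <= s)%O ->
  \sum_(u \in P `&` [set u | (r <= u <= s)%O]) f u =
  f s + \sum_(u \in P `&` [set u | (r <= u < s)%O]) f u.
Proof.
move=> Ps rs; rewrite (fsbigD1 s) //=; last 2 first.
- exact: finite_setIl.
- by split=> //=; rewrite rs lexx.
congr (_ + _); apply: eq_fsbigl; apply/seteqP; split=> u /=.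
  move=> [[Pu /andP[ru us]] /eqP nus]; split=> //.
  by rewrite ru lt_neqAle nus us.
move=> [Pu /andP[ru us]]; split; last by move=> e; rewrite e ltxx in us.
by split=> //; rewrite ru ltW.
Qed.

Lemma sum_mobius_interval (r s : T) : P r -> P s -> (r <= s)%O ->
  \sum_(u \in P `&` [set u | (r <= u <= s)%O]) mobius P r u = (r == s)%:R.
Proof.
move=> Pr Ps rs; rewrite sum_interval_last //.
have [<-|nrs] := eqVneq r s.
  rewrite mobiusxx // fsbig1 ?addr0 // => u [_ /andP[ru ur]].
  by move: (le_lt_trans ru ur); rewrite ltxx.
by rewrite mobius_lt ?addNr // lt_neqAle nrs.
Qed.

(** Strong induction on the size of the interval from [r] to [s]: the prescribed
    sum determines the value at the top of the interval from the values below. *)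
Lemma mobius_unique (f : T -> int) (r t : T) : P r ->
  (forall s, P s -> (r <= s <= t)%O ->
    \sum_(u \in P `&` [set u | (r <= u <= s)%O]) f u = (r == s)%:R) ->
  forall s, P s -> (r <= s <= t)%O -> f s = mobius P r s.
Proof.
move=> Pr fsum s.
have [n] := ubnP (count_set (P `&` [set u | (r <= u <= s)%O])).
elim: n s => // n IHn s len Ps /andP[rs st].
have := fsum s Ps; rewrite rs st => /(_ isT).
rewrite -sum_mobius_interval // !sum_interval_last //.
rewrite [X in _ + X = _ -> _](_ : _ =
  \sum_(u \in P `&` [set u | (r <= u < s)%O]) mobius P r u); first exact: addIr.
apply: eq_fsbigr => u; rewrite inE => -[Pu /andP[ru us]]; apply: IHn => //.
- rewrite -ltnS; apply: leq_trans len; rewrite ltnS.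
  apply: (@count_set_lt _ _ _ s) => //.
  + exact: finite_setIl.
  + by move=> v [Pv /andP[rv vu]]; split=> //=; rewrite rv (le_trans vu (ltW us)).
  + by split=> //=; rewrite rs lexx.
  + by move=> [_ /andP[_ /le_lt_trans/(_ us)]]; rewrite ltxx.
- by rewrite ru (le_trans (ltW us) st).
Qed.

End Mobius.

Section Flats.
Context (R : realType) (d : nat) (H : set (set 'rV[R]_d)).

(** A flat is the intersection of a finite subset of [H]. *)
Lemma finite_flats : finite_set H -> finite_set (flats H).
Proof.
move=> finH.
pose I (S : {fset set 'rV[R]_d}) : set 'rV[R]_d := \bigcap_(A in [set` S]) A.
apply: (@sub_finite_set _ _ (I @` [set` fpowerset (fset_set H)])).
  move=> u [_ [S [SH ->]]]; have finS := sub_finite_set SH finH.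
  exists (fset_set S); last by rewrite /I fset_setK.
  by rewrite /= fpowersetE -fset_set_sub.
exact/finite_image/finite_fset.
Qed.

Lemma flats_setT : flats H setT.
Proof.
split; first by exists 0.
by exists set0; split=> //; rewrite bigcap_set0.
Qed.

Lemma flats_setI (u A : set 'rV[R]_d) : flats H u -> H A ->
  u `&` A !=set0 -> flats H (u `&` A).
Proof.
move=> [_ [S [SH ->]]] HA ne; split=> //; exists (S `|` [set A]); split.
  by move=> B [/SH //|->].
by rewrite bigcap_setU bigcap_set1.
Qed.

Lemma flats_bigcap (x : 'rV[R]_d) (S : set (set 'rV[R]_d)) :
  S `<=` H -> (forall A, S A -> A x) -> flats H (\bigcap_(A in S) A).
Proof. by move=> SH Sx; split; [exists x|exists S]. Qed.

Lemma flats_neqT (u : set 'rV[R]_d) : flats H u -> u != setT ->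
  exists2 A, H A & u `<=` A.
Proof.
move=> [_ [S [SH ->]]] /eqP nT; have [S0|/set0P[A SA]] := eqVneq S set0.
  by case: nT; rewrite S0 bigcap_set0.
by exists A; [exact: SH|exact: bigcap_inf].
Qed.

Lemma dual_interval_set (v : set 'rV[R]_d) :
  [set u : (set 'rV[R]_d)^d%type | ((setT : (set 'rV[R]_d)^d%type) <= u <=
    (v : (set 'rV[R]_d)^d%type))%O] = [set u | v `<=` u].
Proof.
apply/seteqP; split=> u /=; rewrite !leEdual.
  by move=> /andP[_ /subsetPset].
by move=> vu; apply/andP; split; apply/subsetPset.
Qed.

Lemma sum_mobius_flats_above (v : set 'rV[R]_d) : finite_set H -> flats H v ->
  \sum_(u \in flats H `&` [set u | v `<=` u]) mobius_flats H setT u =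
  (v == setT)%:R.
Proof.
move=> finH fv; have finF := finite_flats finH.
have := @sum_mobius_interval _ (set 'rV[R]_d)^d%type _ finF setT v flats_setT fv.
rewrite dual_interval_set leEdual eq_sym; apply; exact/subsetPset.
Qed.

Lemma mobius_flats_unique (f : set 'rV[R]_d -> int) (t : set 'rV[R]_d) :
  finite_set H ->
  (forall v, flats H v -> t `<=` v ->
    \sum_(u \in flats H `&` [set u | v `<=` u]) f u = (v == setT)%:R) ->
  forall v, flats H v -> t `<=` v -> f v = mobius_flats H setT v.
Proof.
move=> finH fsum v fv tv.
apply: (@mobius_unique _ (set 'rV[R]_d)^d%type _ (finite_flats finH) f setT t) => //.
- exact: flats_setT.
- move=> s fs /andP[_ /subsetPset ts].
  by rewrite dual_interval_set eq_sym fsum.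
- by rewrite !leEdual; apply/andP; split; apply/subsetPset.
Qed.

End Flats.

(** * Sign patterns realised on a linear subspace *)

Section SignPatterns.
Context (R : realType) (d : nat).
Implicit Types (a y z v : 'rV[R]_d) (F U : 'M[R]_d) (s : seq 'rV[R]_d).

Definition dot a y : R := (y *m a^T) 0 0.

Lemma dotE a y : dot a y = \sum_(i < d) a ord0 i * y ord0 i.
Proof. by rewrite /dot mxE; apply: eq_bigr => i _; rewrite mxE mulrC. Qed.

Lemma dotD a y z : dot a (y + z) = dot a y + dot a z.
Proof. by rewrite /dot mulmxDl mxE. Qed.

Lemma dotZ a (k : R) y : dot a (k *: y) = k * dot a y.
Proof. by rewrite /dot -scalemxAl mxE. Qed.

Lemma dotN a y : dot a (- y) = - dot a y.
Proof. by rewrite -scaleN1r dotZ mulN1r. Qed.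

Lemma dotB a y z : dot a (y - z) = dot a y - dot a z.
Proof. by rewrite dotD dotN. Qed.

Lemma sub_kermx_dot a y : (y <= kermx a^T)%MS = (dot a y == 0).
Proof.
rewrite sub_kermx; apply/eqP/eqP => [y0|]; first by rewrite /dot y0 mxE.
by rewrite /dot => y0; apply/matrixP => i j; rewrite !ord1 y0 mxE.
Qed.

Lemma continuous_dot a : continuous (dot a).
Proof.
rewrite (_ : dot a = fun y => \sum_(i < d) a ord0 i * y ord0 i); last first.
  by apply/funext => y; rewrite dotE.
apply: continuous_big => [z|i _ y]; first exact: add_continuous.
by apply: cvgMl_tmp; [exact: (nbhs_filter y)|exact: coord_continuous].
Qed.

(** The bound 1 keeps the parameter within a segment. *)
Lemma near0_small (P : set R) : (\forall k \near (0 : R), P k) ->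
  exists2 k, 0 < k <= 1 & P k.
Proof.
move=> /nbhs_ballP[e /= e0 he]; exists (Num.min 1 (e / 2)).
  by rewrite lt_min ltr01 divr_gt0 //= ge_min lexx.
apply: he; rewrite /ball /= sub0r normrN gtr0_norm; last first.
  by rewrite lt_min ltr01 divr_gt0.
by rewrite gt_min ltr_pdivrMr // ltr_pMr // ltr1n // orbT.
Qed.

Lemma continuous_line y z : continuous (fun k : R => y + k *: z).
Proof.
move=> k; apply: cvgD; first exact: cvg_cst.
by apply: cvgZr_tmp; exact: cvg_id.
Qed.

Lemma near_line y z (B : set 'rV[R]_d) : nbhs y B ->
  \forall k \near (0 : R), B (y + k *: z).
Proof.
move=> yB; have := @continuous_line y z 0.
by rewrite /continuous_at scale0r addr0; apply.
Qed.

Definition slice F a : 'M[R]_d := (F :&: kermx a^T)%MS.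

Lemma sub_slice y F a : (y <= slice F a)%MS = (y <= F)%MS && (dot a y == 0).
Proof. by rewrite sub_capmx sub_kermx_dot. Qed.

(** The functional [dot a] maps [F] onto a line when it does not vanish on [F],
    so its kernel has codimension one. *)
Lemma rank_slice F a : ~~ (F <= kermx a^T)%MS -> \rank F = (\rank (slice F a)).+1.
Proof.
move=> Fa; rewrite -(mxrank_mul_ker F a^T) -[RHS]add1n; congr (_ + _)%N.
apply/eqP; rewrite eqn_leq rank_leq_col lt0n mxrank_eq0.
by rewrite -sub_kermx.
Qed.

Lemma slice_direction F a : ~~ (F <= kermx a^T)%MS ->
  exists2 v, (v <= F)%MS & 0 < dot a v.
Proof.
move=> /row_subPn[i]; rewrite sub_kermx_dot => n0.
have [p|n|e] := ltrgtP (dot a (row i F)) 0; last by rewrite e eqxx in n0.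
  by exists (- row i F); [rewrite eqmx_opp row_sub|rewrite dotN oppr_gt0].
by exists (row i F) => //; exact: row_sub.
Qed.

Definition has_sign a (b : bool) y := if b then 0 < dot a y else dot a y < 0.

Definition has_signs s (t : seq bool) y : bool :=
  all2 (fun a b => has_sign a b y) s t.

Lemma has_signs_near s t y : has_signs s t y ->
  \forall z \near y, has_signs s t z.
Proof.
elim: s t => [|a s IHs] [|b t] //=; first by move=> _; near=> z.
move=> /andP[ya ys]; near=> z; apply/andP; split; near: z; last exact: IHs.
rewrite /has_sign; case: b ya => /= ya.
  exact: (cvgr_gt _ (@continuous_dot a y)).
exact: (cvgr_lt _ (@continuous_dot a y)).
Unshelve. all: by end_near. Qed.

Lemma has_signs_small s t y v : has_signs s t y ->
  exists2 e : R, 0 < e & has_signs s t (y + e *: v).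
Proof.
by move=> /has_signs_near /(near_line v) /near0_small[e /andP[e0 _] he]; exists e.
Qed.

Lemma has_signs_cone s t y z (k l : R) : 0 < k -> 0 < l ->
  has_signs s t y -> has_signs s t z -> has_signs s t (k *: y + l *: z).
Proof.
move=> k0 l0; elim: s t => [|a s IHs] [|b t] //= /andP[ya ys] /andP[za zs].
rewrite {}IHs // andbT; move: ya za; rewrite /has_sign dotD !dotZ.
by case: b => p q; [rewrite addr_gt0 // mulr_gt0|
  rewrite -oppr_gt0 opprD -!mulrN addr_gt0 // mulr_gt0 // oppr_gt0].
Qed.

Definition realizable s F (t : seq bool) : Prop :=
  exists2 y, (y <= F)%MS & has_signs s t y.

(** A witness of the pattern [t] on which [dot a] vanishes can be pushed off the
    hyperplane of [a] inside [F], so that it gives a witness with a sign for [a]. *)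
Lemma realizable_or s F a t : ~~ (F <= kermx a^T)%MS ->
  realizable (a :: s) F (true :: t) \/ realizable (a :: s) F (false :: t) <->
  realizable s F t.
Proof.
move=> Fa; split; first by case=> -[y yF /= /andP[_ ys]]; exists y.
move=> [y yF ys]; have [p|n|e] := ltrgtP (dot a y) 0.
- by right; exists y => //=; rewrite /has_sign p.
- by left; exists y => //=; rewrite /has_sign n.
have [v vF av] := slice_direction Fa; left.
have [k k0 hs] := has_signs_small v ys; exists (y + k *: v) => /=.
  by rewrite addmx_sub // scalemx_sub.
by rewrite hs /has_sign dotD dotZ e add0r mulr_gt0.
Qed.

(** Two witnesses of [t] on opposite sides of the hyperplane of [a] have a
    positive combination on it; a witness on it can be pushed to both sides. *)
Lemma realizable_and s F a t : ~~ (F <= kermx a^T)%MS ->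
  realizable (a :: s) F (true :: t) /\ realizable (a :: s) F (false :: t) <->
  realizable s (slice F a) t.
Proof.
move=> Fa; split.
  move=> [[y yF /= /andP[ya ys]] [z zF /= /andP[za zs]]].
  (* positive coefficients, chosen so that [dot a] vanishes *)
  exists ((- dot a z) *: y + dot a y *: z).
    rewrite sub_slice dotD !dotZ addmx_sub ?scalemx_sub //=.
    by rewrite mulrC mulrN addNr.
  by apply: has_signs_cone => //; rewrite oppr_gt0.
move=> [y]; rewrite sub_slice => /andP[yF /eqP ya] ys.
have [v vF av] := slice_direction Fa; split.
  have [k k0 hs] := has_signs_small v ys; exists (y + k *: v) => /=.
    by rewrite addmx_sub // scalemx_sub.
  by rewrite hs /has_sign dotD dotZ ya add0r mulr_gt0.
have [k k0 hs] := has_signs_small (- v) ys; exists (y + k *: - v) => /=.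
  by rewrite addmx_sub // scalemx_sub // eqmx_opp.
by rewrite hs /has_sign dotD dotZ dotN ya add0r mulrN oppr_lt0 mulr_gt0.
Qed.

Fixpoint patterns (n : nat) : seq (seq bool) :=
  if n is n'.+1 then
    [seq true :: t | t <- patterns n'] ++ [seq false :: t | t <- patterns n']
  else [:: [::]].

Lemma mem_patterns n t : (t \in patterns n) = (size t == n).
Proof.
elim: n t => [|n IHn] [|b t] //=; rewrite mem_cat.
  by apply/orP => -[] /mapP[].
rewrite eqSS -IHn; apply/orP/idP => [[] /mapP[u un [_ ->]] //|tn].
by case: b; [left|right]; apply/mapP; exists t.
Qed.

Lemma uniq_patterns n : uniq (patterns n).
Proof.
elim: n => //= n IHn; rewrite cat_uniq !map_inj_uniq ?IHn //=; last 2 first.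
- by move=> u v [].
- by move=> u v [].
by rewrite andbT; apply/hasPn => t /mapP[u _ ->]; apply/mapP => -[].
Qed.

(** The number of regions cut out on [F] by the hyperplanes orthogonal to the
    entries of [s], a region being identified with its sign pattern.  If some
    entry is orthogonal to [F], there are none. *)
Definition nregions s F : nat :=
  count (fun t => `[< realizable s F t >]) (patterns (size s)).

Lemma nregions_nil F : nregions [::] F = 1%N.
Proof.
rewrite /nregions /=; case: asboolP => // -[]; exists 0 => //; exact: sub0mx.
Qed.

Lemma nregions_degenerate a s F : (F <= kermx a^T)%MS -> nregions (a :: s) F = 0%N.
Proof.
move=> Fa; apply/eqP; rewrite -leqn0 leqNgt -has_count; apply/hasPn => t _.
apply/asboolP => -[y yF]; case: t => //= b t.
have := submx_trans yF Fa; rewrite sub_kermx_dot => /eqP ay.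
by rewrite /has_sign ay ltxx; case: b.
Qed.

(** Every pattern realised on [F] extends to [a] in one way, or in two ways
    exactly if it is realised on [slice F a]: inclusion-exclusion on the patterns
    extended by either sign. *)
Lemma nregions_cons a s F : ~~ (F <= kermx a^T)%MS ->
  nregions (a :: s) F = (nregions s F + nregions s (slice F a))%N.
Proof.
move=> Fa; rewrite /nregions /= count_cat !count_map -count_predUI.
congr (_ + _)%N; apply: eq_count => t /=.
  apply/orP/asboolP => [|/(realizable_or s t Fa)].
    by case=> /asboolP h; apply/(realizable_or s t Fa); [left|right].
  by case=> h; [left|right]; apply/asboolP.
apply/andP/asboolP => [[/asboolP p /asboolP q]|/(realizable_and s t Fa) [p q]].
  exact/(realizable_and s t Fa).
by split; apply/asboolP.
Qed.

End SignPatterns.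

(** * Deletion-restriction for the flats through a point *)

Section DeletionRestriction.
Context (R : realType) (d : nat) (x : 'rV[R]_d).
Implicit Types (a : 'rV[R]_d) (F U : 'M[R]_d) (s : seq 'rV[R]_d).
Implicit Types (u v : set 'rV[R]_d).

Definition flat_at F : set 'rV[R]_d := [set y | (y - x <= F)%MS].

Definition hyper_at a : set 'rV[R]_d := [set y | dot a (y - x) = 0].

Lemma flat_at_self F : flat_at F x.
Proof. by rewrite /flat_at /= subrr sub0mx. Qed.

Lemma flat_at1 : flat_at 1%:M = setT.
Proof. by apply/seteqP; split=> // y _; rewrite /flat_at /= submx1. Qed.

Lemma flat_at_slice F a : flat_at (slice F a) = flat_at F `&` hyper_at a.
Proof.
apply/seteqP; split=> y; rewrite /flat_at /hyper_at /= sub_slice.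
  by move=> /andP[-> /eqP ->].
by move=> [-> ->]; rewrite eqxx.
Qed.

Lemma flat_at_inj F U : flat_at F = flat_at U -> (F :=: U)%MS.
Proof.
move=> e; apply/eqmxP/andP; split; apply/row_subP => i.
  have : flat_at F (x + row i F) by rewrite /flat_at /= addrC addKr row_sub.
  by rewrite e /flat_at /= addrC addKr.
have : flat_at U (x + row i U) by rewrite /flat_at /= addrC addKr row_sub.
by rewrite -e /flat_at /= addrC addKr.
Qed.

(** By induction, the sum of [(-1) ^ #|S|] over the sublists [S] of [s] such that
    [flat_at F] meets the hyperplanes of [S] in [u]: Whitney's formula for the
    Möbius function, organised along the list. *)
Fixpoint mobius_wt s F u : int :=
  if s is a :: s' then mobius_wt s' F u - mobius_wt s' (slice F a) u
  else (flat_at F == u)%:R.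

(** The recursion of [mobius_wt] without its signs; the degenerate case, in which
    the two terms of [mobius_wt] cancel, has to be singled out. *)
Fixpoint mobius_abs s F u : nat :=
  if s is a :: s' then
    if (F <= kermx a^T)%MS then 0%N
    else (mobius_abs s' F u + mobius_abs s' (slice F a) u)%N
  else (flat_at F == u).

Lemma eq_mobius_wt s F U u : (F :=: U)%MS -> mobius_wt s F u = mobius_wt s U u.
Proof.
elim: s F U => [|a s IHs] F U e /=.
  suff -> : flat_at F = flat_at U by [].
  by apply/seteqP; split=> y; rewrite /flat_at /= e.
by rewrite (IHs _ _ e) (IHs (slice F a) (slice U a)) //; exact: cap_eqmx.
Qed.

(** If [u] is the flat of [U], the weight has sign [(-1) ^ (\rank F - \rank U)]:
    restricting to [slice F a] changes both the sign in front of the weight and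
    the parity of the rank.  If [u] is not such a flat, both sides vanish. *)
Lemma normr_mobius_wt s F u : `|mobius_wt s F u| = (mobius_abs s F u)%:R.
Proof.
have [[U ->]|noU] := pselect (exists U, u = flat_at U); last first.
  have nu F' : (flat_at F' == u) = false by apply/eqP => e; apply: noU; exists F'.
  have -> : mobius_wt s F u = 0.
    by elim: s F => [|a s IHs] F /=; rewrite ?nu // !IHs subrr.
  have -> : mobius_abs s F u = 0%N; last by rewrite normr0.
  by elim: s F => [|a s IHs] F /=; rewrite ?nu // !IHs if_same.
suff -> : mobius_wt s F (flat_at U) =
    (-1) ^+ (\rank F + \rank U) * (mobius_abs s F (flat_at U))%:R.
  by rewrite normrM normrX normrN normr1 expr1n mul1r normr_nat.
elim: s F => [|a s IHs] F /=.
  have [/flat_at_inj ->|_] := eqVneq; last by rewrite mulr0.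
  by rewrite mulr1 addnn -mul2n exprM sqrrN !expr1n.
case: ifPn => Fa.
  (* [slice F a] has the row space of [F]: the two terms cancel *)
  rewrite mulr0 (eq_mobius_wt _ _ (_ : (slice F a :=: F)%MS)) ?subrr //.
  exact/capmx_idPl.
rewrite !IHs (rank_slice Fa) natrD addSn exprS.
by rewrite mulrDr !mulN1r !mulNr.
Qed.

Context (H : set (set 'rV[R]_d)).
Context (finH : finite_set H).

Lemma flats_slice F a : flats H (flat_at F) -> H (hyper_at a) ->
  flats H (flat_at (slice F a)).
Proof.
move=> fF Ha; rewrite flat_at_slice; apply: flats_setI => //.
by exists x; rewrite -flat_at_slice; exact: flat_at_self.
Qed.

(** By induction on [s]: [v] is contained in [flat_at (slice F a)] if and only if
    it is contained in both [flat_at F] and the hyperplane of [a], so the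
    difference keeps the [v] contained in [flat_at F] but not in that hyperplane. *)
Lemma sum_mobius_wt_above s F v : (forall a, a \in s -> H (hyper_at a)) ->
  flats H (flat_at F) ->
  \sum_(u \in flats H `&` [set u | v `<=` u]) mobius_wt s F u =
  (`[< v `<=` flat_at F >] && all (fun a => ~~ `[< v `<=` hyper_at a >]) s)%:R.
Proof.
have finI : finite_set (flats H `&` [set u | v `<=` u]).
  exact/finite_setIl/finite_flats.
elim: s F => [|a s IHs] F Hs fF /=.
  rewrite andbT; have [vF|vF] := asboolP (v `<=` flat_at F).
    rewrite (fsbigD1 (flat_at F)) //= eqxx fsbig1 ?addr0 // => u [_ /eqP nu].
    by rewrite eq_sym (negbTE nu).
  rewrite fsbig1 // => u [_ /= vu]; have [e|//] := eqVneq.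
  by case: vF; rewrite e.
have Hs' b : b \in s -> H (hyper_at b).
  by move=> bs; apply: Hs; rewrite inE bs orbT.
have Ha : H (hyper_at a) by apply: Hs; rewrite inE eqxx.
rewrite fsbig_finite // sumrB -!fsbig_finite // IHs // IHs //; last exact: flats_slice.
rewrite flat_at_slice [in X in _ - X]subsetI asbool_and.
by case: `[< v `<=` flat_at F >]; case: `[< v `<=` hyper_at a >];
  case: all.
Qed.

(** Zaslavsky's theorem for the hyperplanes through [x]: both sides satisfy the
    same deletion-restriction recursion. *)
Lemma sum_mobius_abs s F : (forall a, a \in s -> H (hyper_at a)) ->
  flats H (flat_at F) ->
  (\sum_(u \in flats H) mobius_abs s F u)%R = nregions s F.
Proof.
have finF := finite_flats finH.
elim: s F => [|a s IHs] F Hs fF /=.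
  rewrite nregions_nil (fsbigD1 (flat_at F)) //= eqxx fsbig1 // => u [_ /eqP nu].
  by rewrite eq_sym (negbTE nu).
have Hs' b : b \in s -> H (hyper_at b).
  by move=> bs; apply: Hs; rewrite inE bs orbT.
have Ha : H (hyper_at a) by apply: Hs; rewrite inE eqxx.
have [Fa|Fa] := boolP (F <= kermx a^T)%MS; first by rewrite nregions_degenerate // fsbig1.
rewrite fsbig_split //= IHs // IHs ?nregions_cons //; exact: flats_slice.
Qed.

End DeletionRestriction.

(** * Regions of a convex set around one of its points *)

Section SignLists.
Context (R : realType) (d : nat).
Implicit Types (a y z : 'rV[R]_d) (s : seq 'rV[R]_d) (t : seq bool).

Lemma has_signs_scale s t y z (k : R) : 0 < k ->
  (forall a, a \in s -> dot a z = k * dot a y) -> has_signs s t y ->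
  has_signs s t z.
Proof.
move=> k0; elim: s t => [|a s IHs] [|b t] //= yz /andP[ya ys].
rewrite IHs //; last by move=> c cs; apply: yz; rewrite inE cs orbT.
rewrite andbT; move: ya; rewrite /has_sign (yz a) ?inE ?eqxx //.
by case: b; rewrite ?pmulr_rgt0 ?pmulr_rlt0.
Qed.

Lemma has_signs_same_side s t y z : has_signs s t y ->
  has_signs s t z <-> forall a, a \in s -> 0 < dot a y * dot a z.
Proof.
elim: s t => [|a s IHs] [|b t] //= /andP[ya ys].
have same : has_sign a b z = (0 < dot a y * dot a z).
  by move: ya; rewrite /has_sign; case: b => h;
    rewrite ?(pmulr_rgt0 _ h) ?(nmulr_rgt0 _ h).
rewrite same; split=> [/andP[za zs] c|az].
  by rewrite inE => /predU1P[->//|]; exact: ((IHs _ ys).1 zs).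
rewrite az ?inE ?eqxx //=; apply/(IHs _ ys) => c cs.
by apply: az; rewrite inE cs orbT.
Qed.

Lemma has_signs_inj s t t' y z : has_signs s t y -> has_signs s t' z ->
  (forall a, a \in s -> 0 <= dot a y * dot a z) -> t = t'.
Proof.
elim: s t t' => [|a s IHs] [|b t] [|b' t'] //= /andP[ya ys] /andP[za zs] az.
congr (_ :: _); last first.
  by apply: IHs => // c cs; apply: az; rewrite inE cs orbT.
have := az a; rewrite inE eqxx => /(_ isT).
move: ya za; rewrite /has_sign; case: b; case: b' => //= ya za.
  by rewrite leNgt pmulr_rlt0 // za.
by rewrite leNgt nmulr_rlt0 // za.
Qed.

Lemma has_signs_exists s y : (forall a, a \in s -> dot a y != 0) ->
  has_signs s [seq 0 < dot a y | a <- s] y.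
Proof.
elim: s => //= a s IHs n0; rewrite IHs; last first.
  by move=> c cs; apply: n0; rewrite inE cs orbT.
rewrite andbT /has_sign; case: ltrgtP => // e.
by have := n0 a; rewrite inE eqxx e eqxx => /(_ isT).
Qed.

Lemma same_side_trans (p q r : R) : 0 < p * q -> 0 < q * r -> 0 < p * r.
Proof.
have [q0|q0|->] := ltrgtP q 0; last by rewrite mulr0 ltxx.
  by rewrite nmulr_lgt0 // nmulr_rgt0 // => p0 r0; rewrite nmulr_rgt0.
by rewrite pmulr_lgt0 // pmulr_rgt0 // => p0 r0; rewrite pmulr_rgt0.
Qed.

End SignLists.

Section Cells.
Context (R : realType) (d : nat) (C : set 'rV[R]_d).
Context (H : set (set 'rV[R]_d)) (Cconvex : convex_set C).
Context (finH : finite_set H).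
Context (normal : set 'rV[R]_d -> 'rV[R]_d) (offset : set 'rV[R]_d -> R).
Context (HE : forall A, H A -> A = [set y | dot (normal A) y = offset A]).
Implicit Types (x y z : 'rV[R]_d) (A : set 'rV[R]_d).

Lemma convex_segment y z (k : R) : C y -> C z -> 0 <= k <= 1 ->
  C (y + k *: (z - y)).
Proof.
move=> Cy Cz /andP[k0 k1].
have := @Cconvex z y (Itv01 k0 k1) (mem_set Cz) (mem_set Cy).
rewrite inE; congr C; rewrite /conv /= /unstable.onem scalerBl scale1r scalerBr.
by rewrite addrC -addrA [- _ + _]addrC.
Qed.

Definition side A y : R := dot (normal A) y - offset A.

Lemma side_eq0 A y : H A -> (side A y == 0) = `[< A y >].
Proof.
move=> HA; rewrite subr_eq0; apply/eqP/asboolP; first by rewrite [in X in _ -> X](HE HA).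
by move=> Ay; have := Ay; rewrite [in X in X -> _](HE HA).
Qed.

Lemma side_through A x y : H A -> A x -> side A y = dot (normal A) (y - x).
Proof.
move=> HA Ax; have /eqP : side A x == 0 by rewrite side_eq0 //; apply/asboolP.
by rewrite dotB /side => /eqP; rewrite subr_eq0 => /eqP ->.
Qed.

Lemma side_line A y z (k : R) :
  side A (y + k *: (z - y)) = (1 - k) * side A y + k * side A z.
Proof. by rewrite /side dotD dotZ dotB; ring. Qed.

Lemma continuous_side A : continuous (side A).
Proof.
move=> y; apply: (@cvgB R R^o _ _ (nbhs_filter y) (dot (normal A)) (cst (offset A))).
  exact: continuous_dot.
exact: cvg_cst.
Qed.

Lemma side_near A y (k : R) : 0 < k * side A y ->
  \forall z \near y, 0 < k * side A z.
Proof.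
move=> ky; have cs : (fun z => k * side A z) @ y --> k * side A y.
  by apply: cvgMl_tmp; [exact: (nbhs_filter y)|exact: continuous_side].
exact: (cvgr_gt _ cs).
Qed.

Lemma arrangement_complE y : arrangement_compl C H y <->
  C y /\ forall A, H A -> side A y != 0.
Proof.
split=> [[Cy nH]|[Cy nH]]; split=> //.
  by move=> A HA; rewrite side_eq0 //; apply/asboolP => Ay; apply: nH; exists A.
by move=> [A HA Ay]; have := nH A HA; rewrite side_eq0 // => /negP; apply; apply/asboolP.
Qed.

Definition cell y : set 'rV[R]_d :=
  [set z | C z /\ forall A, H A -> 0 < side A y * side A z].

(** The component lies in the cell, since [side A] maps it to an interval that
    avoids 0.  Conversely a segment between two points of the cell stays in the
    convex set [C] and meets no hyperplane. *)
Lemma componentE y : arrangement_compl C H y ->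
  connected_component (arrangement_compl C H) y = cell y.
Proof.
move=> yC; have [Cy nH] := (arrangement_complE y).1 yC.
apply/seteqP; split=> z.
  move=> yz; have zC := connected_component_sub yz.
  have [Cz nHz] := (arrangement_complE z).1 zC.
  split=> // A HA; rewrite ltNge; apply/negP => neg.
  pose B := connected_component (arrangement_compl C H) y.
  have /connected_intervalP itv : connected (side A @` B).
    apply: connected_continuous_connected; first exact: component_connected.
    by apply: continuous_subspaceT; exact: continuous_side.
  have Iy : (side A @` B) (side A y) by exists y => //; exact: connected_component_refl.
  have Iz : (side A @` B) (side A z) by exists z.
  have [w Bw w0] : (side A @` B) 0.
    have [y0|y0|e] := ltrgtP (side A y) 0; last by have := nH A HA; rewrite e eqxx.
      by apply: (itv _ _ Iy Iz); rewrite ltW //= -(nmulr_rle0 _ y0).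
    by apply: (itv _ _ Iz Iy); rewrite (ltW y0) andbT -(pmulr_rle0 _ y0).
  have /arrangement_complE[_ nw] := connected_component_sub Bw.
  by have := nw A HA; rewrite w0 eqxx.
move=> [Cz same]; pose f k := y + k *: (z - y).
have f01 : connected (f @` `[0, 1]).
  apply: connected_continuous_connected; first exact: segment_connected.
  by apply: continuous_subspaceT; exact: continuous_line.
apply: (connected_component_max _ _ f01).
- by exists 0; [rewrite /= in_itv /= lexx ler01|rewrite /f scale0r addr0].
- move=> w [k /=]; rewrite in_itv /= => k01 <- {w}; apply/arrangement_complE; split.
    exact: convex_segment.
  move=> A HA; rewrite side_line; apply/eqP => e.
  have /andP[k0 k1] := k01.
  (* a convex combination of two values with the sign of [side A y] *)
  have : 0 < side A y * ((1 - k) * side A y + k * side A z).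
    rewrite mulrDr !(mulrCA (side A y)).
    have yy : 0 < side A y * side A y by rewrite -expr2 exprn_even_gt0 //= nH.
    move: k0; rewrite le_eqVlt => /predU1P[<-|k0].
      by rewrite subr0 mul1r mul0r addr0.
    by apply: ltr_wpDl; [rewrite mulr_ge0 ?subr_ge0 ?(ltW yy)|rewrite mulr_gt0 ?same].
  by rewrite e mulr0 ltxx.
- by exists 1; [rewrite /= in_itv /= lexx ler01|rewrite /f scale1r addrC subrK].
Qed.

Lemma closure_cell_side x y A : H A -> closure (cell y) x ->
  0 <= side A y * side A x.
Proof.
move=> HA cx; rewrite leNgt -oppr_gt0 -mulNr; apply/negP => /side_near /cx.
move=> [z [[_ /(_ A HA) same]]]; rewrite /= mulNr oppr_gt0 => /(lt_trans same).
by rewrite ltxx.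
Qed.

Context (x : 'rV[R]_d) (Cx : C x).

Definition normals_at : seq 'rV[R]_d :=
  [seq normal A | A <- fset_set H & `[< A x >]].

Lemma normals_atP a : reflect (exists2 A, H A /\ A x & a = normal A)
  (a \in normals_at).
Proof.
apply: (iffP mapP) => -[A].
  rewrite mem_filter in_fset_set // => /andP[/asboolP Ax] /set_mem HA ->.
  by exists A.
move=> [HA Ax] ->; exists A => //; rewrite mem_filter in_fset_set // mem_set //.
by rewrite andbT; apply/asboolP.
Qed.

(** Among the regions with pattern [t] at the hyperplanes through [x], the only
    one that can have [x] in its closure: no other hyperplane separates it from
    [x]. *)
Definition cone (t : seq bool) : set 'rV[R]_d :=
  [set z | [/\ C z, has_signs normals_at t (z - x) &
     forall A, H A -> ~ A x -> 0 < side A x * side A z]].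

Lemma cone_cell t y : cone t y -> arrangement_compl C H y /\ cone t = cell y.
Proof.
move=> [Cy ty fary].
have yy A : H A -> A x -> 0 < side A y * side A y.
  move=> HA Ax; rewrite (side_through _ HA Ax).
  by apply: (has_signs_same_side _ ty).1 => //; apply/normals_atP; exists A.
split.
  apply/arrangement_complE; split=> // A HA; have [Ax|Ax] := pselect (A x).
    by have := yy A HA Ax; rewrite -expr2 exprn_even_gt0.
  by have := fary A HA Ax; apply: contraTneq => ->; rewrite mulr0 ltxx.
apply/seteqP; split=> z [Cz].
  move=> tz farz; split=> // A HA; have [Ax|Ax] := pselect (A x).
    rewrite !(side_through _ HA Ax).
    by apply: (has_signs_same_side _ ty).1 => //; apply/normals_atP; exists A.
  by apply: (same_side_trans (q := side A x)); [rewrite mulrC fary|rewrite farz].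
move=> same; split=> //.
  apply/(has_signs_same_side _ ty) => a /normals_atP[A [HA Ax] ->].
  by rewrite -!(side_through _ HA Ax) same.
by move=> A HA Ax; apply: (same_side_trans (q := side A y)); [rewrite fary|rewrite same].
Qed.

(** Signs at hyperplanes missing [x] are inherited from [x] by every cell that
    has [x] in its closure; the vector [y - x] realises the remaining ones. *)
Lemma cell_cone y : arrangement_compl C H y -> closure (cell y) x ->
  exists t, realizable normals_at 1%:M t /\ cone t y.
Proof.
move=> yC cx; have [Cy nH] := (arrangement_complE y).1 yC.
have ty : has_signs normals_at [seq 0 < dot a (y - x) | a <- normals_at] (y - x).
  apply: has_signs_exists => a /normals_atP[A [HA Ax] ->].
  by rewrite -(side_through _ HA Ax) nH.
eexists; split; first by exists (y - x); [exact: submx1|exact: ty].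
split=> // A HA Ax; rewrite lt_neqAle eq_sym mulrC closure_cell_side // andbT.
rewrite mulf_neq0 //; first by rewrite nH.
by rewrite side_eq0 //; apply/asboolP.
Qed.

(** A point of the first cone is in the closure of the second, hence weakly on the
    side of its points at each hyperplane; as it lies on no hyperplane, the signs
    agree. *)
Lemma cone_inj t t' : cone t !=set0 -> cone t' !=set0 ->
  closure (cone t) = closure (cone t') -> t = t'.
Proof.
move=> [y ty] [z tz] e; have [_ tzE] := cone_cell tz.
have cy : closure (cell z) y by rewrite -tzE -e; exact: subset_closure.
case: ty tz => [_ ty _] [_ tz _]; apply: (has_signs_inj ty tz) => a.
move=> /normals_atP[A [HA Ax] ->].
by rewrite -!(side_through _ HA Ax) mulrC closure_cell_side.
Qed.

(** The step that uses transversality, through the point [y0] of the interior of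
    [C].  Displacing [y0] by a small multiple of a vector [v] that realises [t]
    gives a point [p] of [C] such that [p - x] has the signs of [v] at the
    hyperplanes through [x].  Points of the segment from [x] to [p] keep these
    signs, and close to [x] they have the signs of [x] at the other hyperplanes. *)
Lemma closure_cone_self t y0 : (forall A, H A -> A x -> A y0) ->
  (\forall y \near y0, C y) -> realizable normals_at 1%:M t ->
  cone t !=set0 /\ closure (cone t) x.
Proof.
move=> xy0 nearC [v _ tv].
have [e /andP[e0 _] Ce] := near0_small (near_line v nearC).
set p := y0 + e *: v in Ce.
have far : \forall z \near x, forall A, H A -> ~ A x -> 0 < side A x * side A z.
  have : nbhs x (\bigcap_(A in [set` fset_set H])
      [set z | ~ A x -> 0 < side A x * side A z]).
    apply: filter_bigI => A; rewrite in_fset_set // => /set_mem HA.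
    have [Ax|Ax] := pselect (A x); first by apply: filterS filterT => z _ /(_ Ax).
    apply: filterS (@side_near A x (side A x) _) => [z zx _ //|].
    by rewrite -expr2 exprn_even_gt0 //= side_eq0 //; apply/asboolP.
  apply: filterS => z fz A HA; apply: fz.
  by rewrite /= in_fset_set // mem_set.
have meet B : nbhs x B -> (cone t `&` B) !=set0.
  move=> xB; have [k /andP[k0 k1] [Bk fk]] :=
    near0_small (near_line (p - x) (filterI xB far)).
  exists (x + k *: (p - x)); split=> //; split=> //.
    by apply: convex_segment => //; rewrite (ltW k0).
  apply: (has_signs_scale (y := v) (k := k * e)) tv; first exact: mulr_gt0.
  move=> a /normals_atP[A [HA Ax] ->].
  rewrite addrC addKr dotZ -mulrA /p -addrA addrC -addrA dotD dotZ.
  rewrite [- x + _]addrC -(side_through _ HA Ax).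
  suff /eqP -> : side A y0 == 0 by rewrite addr0.
  by rewrite side_eq0 //; apply/asboolP; exact: xy0.
split=> //; have [|z [? _]] := meet setT; first exact: filterT.
by exists z.
Qed.

Lemma closed_regions_at y0 : (forall A, H A -> A x -> A y0) ->
  (\forall y \near y0, C y) ->
  closed_regions C H `&` [set K | K x] =
  (fun t => closure (cone t)) @` [set t | realizable normals_at 1%:M t].
Proof.
move=> xy0 nearC; apply/seteqP; split=> K.
  move=> [[y yC <-] /=]; rewrite componentE // => cx.
  have [t [rt ty]] := cell_cone yC cx; exists t => //.
  by have [_ ->] := cone_cell ty.
move=> [t rt <-]; have [[y ty] cx] := closure_cone_self xy0 nearC rt.
split=> //; have [yC ->] := cone_cell ty.
by exists y => //; rewrite componentE.
Qed.

(** The closed regions at [x] are in bijection with the realisable patterns, by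
    [closed_regions_at] and [cone_inj]. *)
Lemma multiplicityE y0 : (forall A, H A -> A x -> A y0) ->
  (\forall y \near y0, C y) -> multiplicity C H x = nregions normals_at 1%:M.
Proof.
move=> xy0 nearC; rewrite /multiplicity mem_set // (closed_regions_at xy0 nearC).
pose r := [seq t <- patterns (size normals_at) | `[< realizable normals_at 1%:M t >]].
have rP t : t \in r <-> realizable normals_at 1%:M t.
  rewrite mem_filter mem_patterns; split=> [/andP[/asboolP //]|rt].
  apply/andP; split; first exact/asboolP.
  by case: rt => y _; rewrite /has_signs all2E => /andP[/eqP ->].
have -> : (fun t => closure (cone t)) @` [set t | realizable normals_at 1%:M t] =
    [set` [seq closure (cone t) | t <- r]].
  apply/seteqP; split=> [_ [t /rP rt <-]|K /mapP[t /rP rt ->]]; last by exists t.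
  by apply/mapP; exists t.
rewrite count_set_seq ?size_map ?size_filter // map_inj_in_uniq.
  by rewrite filter_uniq // uniq_patterns.
move=> t t' /rP rt /rP rt'; apply: cone_inj.
- by have [] := closure_cone_self xy0 nearC rt.
- by have [] := closure_cone_self xy0 nearC rt'.
Qed.

End Cells.

(** * The contribution of one point *)

Section PointwiseCounts.
Context (R : realType) (d : nat) (H : set (set 'rV[R]_d)).
Context (finH : finite_set H) (Hnondeg : ~ H setT).
Implicit Types (u v : set 'rV[R]_d) (x : 'rV[R]_d).

Definition minimal_flat x : set 'rV[R]_d := \bigcap_(A in H `&` [set A | A x]) A.

Lemma minimal_flat_self x : minimal_flat x x.
Proof. by move=> A []. Qed.

Lemma flats_minimal_flat x : flats H (minimal_flat x).
Proof. by apply: (@flats_bigcap _ _ _ x) => [A []|A []]. Qed.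

Lemma minimal_flat_sub x u : flats H u -> (minimal_flat x `<=` u) <-> u x.
Proof.
move=> [_ [S [SH ->]]]; split=> [|ux]; first by apply; exact: minimal_flat_self.
by move=> y xy A SA; apply: xy; split; [exact: SH|exact: ux].
Qed.

Lemma flats_above_minimal x :
  flats H `&` [set u | minimal_flat x `<=` u] = flats H `&` [set u | u x].
Proof. by apply/seteqP; split=> u [fu /(minimal_flat_sub x fu)]. Qed.

Lemma flat_eqT v : flats H v -> (v == setT) = `[< forall A, H A -> ~ v `<=` A >].
Proof.
move=> fv; apply/eqP/asboolP => [-> A HA TA|nA].
  by apply: Hnondeg; rewrite -(_ : A = setT) //; apply/seteqP; split.
by apply/eqP; apply: contrapT => /negP /(flats_neqT fv)[A HA /nA]; exact.
Qed.

(** The flats through [x] form the interval from [setT] to [minimal_flat x], over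
    which the Möbius function sums to 0 unless the interval is a single flat. *)
Lemma sum_mobius_through x :
  \sum_(u \in flats H `&` [set u | u x]) mobius_flats H setT u =
  (`[< forall A, H A -> ~ A x >])%:R.
Proof.
rewrite -flats_above_minimal sum_mobius_flats_above //; last exact: flats_minimal_flat.
rewrite flat_eqT; last exact: flats_minimal_flat.
congr (nat_of_bool _)%:R; apply: asbool_equiv_eq; split=> nA A HA.
  by move=> Ax; apply: (nA A HA) => y; apply.
by move=> /(_ x (@minimal_flat_self x)); exact: nA.
Qed.

Lemma mobius_abs_support (x : 'rV[R]_d) s F u : ~ u x -> mobius_abs x s F u = 0%N.
Proof.
move=> nux; elim: s F => [|a s IHs] F /=; last by rewrite !IHs if_same.
by case: eqVneq => // e; case: nux; rewrite -e; exact: flat_at_self.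
Qed.

(** On the flats through [x], [mobius_wt] is the Möbius function, so its absolute
    value [mobius_abs] can be summed by [sum_mobius_abs]. *)
Lemma sum_norm_mobius_through x (s : seq 'rV[R]_d) :
  (forall A, H A /\ A x <-> exists2 a, a \in s & A = hyper_at x a) ->
  \sum_(u \in flats H `&` [set u | u x]) `|mobius_flats H setT u| =
  (nregions s 1%:M)%:Z.
Proof.
move=> sP; have finF := finite_flats finH.
have sH a : a \in s -> H (hyper_at x a).
  by move=> as_; have [] := (sP (hyper_at x a)).2 (ex_intro2 _ _ a as_ erefl).
have fT : flats H (flat_at x 1%:M) by rewrite flat_at1; exact: flats_setT.
rewrite -(sum_mobius_abs finH sH fT).
have wtE u : flats H u -> minimal_flat x `<=` u ->
    mobius_wt x s 1%:M u = mobius_flats H setT u.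
  apply: mobius_flats_unique => // v fv xv.
  rewrite sum_mobius_wt_above // flat_at1 flat_eqT // asboolT // andTb.
  congr (nat_of_bool _)%:R; apply/allP/asboolP => [nA A HA vA|nA a as_].
    have [a as_ Aa] := (sP A).1 (conj HA (vA _ ((minimal_flat_sub x fv).1 xv))).
    by have /asboolP := nA a as_; rewrite -Aa.
  by apply/asboolP; apply: nA; exact: sH.
rewrite -flats_above_minimal.
transitivity (\sum_(u \in flats H `&` [set u | minimal_flat x `<=` u])
    (mobius_abs x s 1%:M u)%:Z).
  apply: eq_fsbigr => u; rewrite inE => -[fu xu].
  by rewrite -wtE // normr_mobius_wt natz.
rewrite (fsbig_widen _ (flats H)); last 2 first.
- exact: subIsetl.
- move=> u [fu nu] /=; rewrite mobius_abs_support // => ux; apply: nu.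
  by split=> //; apply/minimal_flat_sub.
by rewrite Posz_fsum.
Qed.

End PointwiseCounts.

Lemma hyperplane_equations (R : realType) (d : nat) (H : set (set 'rV[R]_d)) :
  is_arrangement H -> ~ H setT ->
  exists (normal : set 'rV[R]_d -> 'rV[R]_d) (offset : set 'rV[R]_d -> R),
    forall A, H A -> A = [set y | dot (normal A) y = offset A].
Proof.
move=> [_ hypH] nT.
have /choice[eqn eqnP] A : exists p : 'rV[R]_d * R,
    H A -> A = [set y | dot p.1 y = p.2].
  have [HA|nHA] := pselect (H A); last by exists (0, 0).
  have [[a [b [_ ->]]]|AT] := hypH A HA; last by case: nT; rewrite -AT.
  by exists (a, b) => _; apply/seteqP; split=> y /=; rewrite dotE.
by exists (fst \o eqn), (snd \o eqn).
Qed.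

(** For a full-dimensional [C] the relative interior is the interior, and a flat
    through a point of [C] meets the closure of [C]. *)
Lemma transverse_interior_point (R : realType) (d : nat) (C : set 'rV[R]_d)
    (H : set (set 'rV[R]_d)) (u : set 'rV[R]_d) (x : 'rV[R]_d) :
  full_dimensional C -> transverse H C -> flats H u -> C x -> u x ->
  exists2 y, u y & \forall z \near y, C z.
Proof.
move=> Cfull [tr _] fu Cx ux.
have [|y [uy [_ nearC]]] := tr u fu; first by exists x; split=> //; exact: subset_closure.
exists y => //; apply: filterS nearC => z; apply.
by rewrite (_ : affine_hull C = setT).
Qed.

Lemma multiplicity_flats (R : realType) (d : nat) (C : set 'rV[R]_d)
    (H : set (set 'rV[R]_d)) (x : 'rV[R]_d) :
  full_dimensional C -> convex_set C -> is_arrangement H -> ~ H setT ->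
  transverse H C -> C x ->
  (multiplicity C H x)%:Z =
  \sum_(u \in flats H `&` [set u | u x]) `|mobius_flats H setT u|.
Proof.
move=> Cfull Cconvex Harr nT tr Cx; have finH := Harr.1.
have [normal [offset HE]] := hyperplane_equations Harr nT.
have [y0 uy0 nearC] := transverse_interior_point Cfull tr
  (flats_minimal_flat H x) Cx (@minimal_flat_self _ _ H x).
have xy0 A : H A -> A x -> A y0 by move=> HA Ax; apply: uy0.
rewrite (multiplicityE Cconvex finH HE Cx xy0 nearC).
have hyperE A : H A -> A x -> A = hyper_at x (normal A).
  move=> HA Ax; apply/seteqP; split=> y; rewrite /hyper_at /= -(side_through HE _ HA Ax).
    by move=> Ay; apply/eqP; rewrite (side_eq0 HE) //; apply/asboolP.
  by move=> /eqP; rewrite (side_eq0 HE) // => /asboolP.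
rewrite (sum_norm_mobius_through finH nT (s := normals_at H normal x)) // => A.
split=> [[HA Ax]|[a /normals_atP[//|B [HB Bx] ->] ->]]; last by rewrite -hyperE.
by exists (normal A); [apply/normals_atP => //; exists A|exact: hyperE].
Qed.

Theorem theorem3p1 (R : realType) (d : nat) (C : set 'rV[R]_d)
    (H : set (set 'rV[R]_d)) (D : set 'rV[R]_d)
    (Cfull : full_dimensional C)
    (Cbounded : bounded_set C)
    (Cconvex : convex_set C)
    (Harr : is_arrangement H)
    (Hnondeg : ~ H setT)
    (Ddiscrete : locally_finite_set D) :
  (open_enumerator C H D)%:Z =
    \sum_(u \in flats H) mobius_flats H setT u * (count_set (D `&` C `&` u))%:Z
  /\
  (transverse H C ->
   (closed_enumerator C H D)%:Z =
    \sum_(u \in flats H)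
       `|mobius_flats H setT u| * (count_set (D `&` C `&` u))%:Z).
Proof.
have finH := Harr.1; have finF := finite_flats finH.
have finDC : finite_set (D `&` C) := Ddiscrete C Cbounded.
split=> [|tr]; rewrite sum_mul_count_set //.
  have -> : open_enumerator C H D = count_set (D `&` C `&` ~` \bigcup_(A in H) A).
    by congr count_set; rewrite /arrangement_compl setDE setIA.
  rewrite count_setIE //; apply: eq_fsbigr => z _.
  rewrite sum_mobius_through //; congr (nat_of_bool _)%:R.
  apply: asbool_equiv_eq; split=> [nz A HA Az|nz [A HA Az]]; last exact: (nz A).
  by apply: nz; exists A.
rewrite /closed_enumerator -(fsbig_widen (D `&` C) D); last 2 first.
- exact: subIsetl.
- by move=> z [Dz nz]; rewrite /= /multiplicity memNset // => Cz; apply: nz.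
rewrite Posz_fsum //; apply: eq_fsbigr => z; rewrite inE => -[_ Cz].
exact: multiplicity_flats.
Qed.
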